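(* Let $0<\alpha<1$, $\lambda>0$, $\mu>0$, and let $N^\alpha_\mu(t)=N^\alpha(G_\mu(t))$, $t\ge0$, be the geometric space-fractional Poisson process. For every $t\ge0$ and every $k\in\mathbb{N}_0=\{0,1,2,\dots\}$, $$\mathbb{P}[N^\alpha_\mu(t)=k]=\sum_{r=0}^\infty\binom{\alpha r}{k}\frac{(-\lambda^\alpha)^r(-1)^k}{r!}\,w_r(\mu t),$$ where $w_r$ is the geometric polynomial of degree $r$.
   Context: The space-fractional Poisson process is $N^\alpha(t)=N(D^\alpha(t))$, where $N$ is a homogeneous Poisson process with intensity $\lambda>0$ and $D^\alpha$ is an independent $\alpha$-stable subordinator, $\mathbb{E}[e^{-sD^\alpha(t)}]=e^{-ts^\alpha}$. The geometric counting process $\{G_\mu(t)\}_{t\ge0}$ with parameter $\mu>0$ is the mixed Poisson process whose random rate is exponentially distributed with mean $\mu$, so $\mathbb{P}[G_\mu(t)=k]=\frac{1}{1+\mu t}\left(\frac{\mu t}{1+\mu t}\right)^k$, $k=0,1,2,\dots$; it is independent of $N^\alpha$. The geometric polynomials are $w_n(y)=\sum_{k=0}^n{n\brace k}k!\,y^k$, where ${n\brace k}=\frac{1}{k!}\sum_{i=0}^k(-1)^i\binom{k}{i}(k-i)^n$ are the Stirling numbers of the second kind. For real $x$ and integer $k\ge0$, $\binom{x}{k}=x(x-1)\cdots(x-k+1)/k!$.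
   Formalization: The series diverges for large t (e.g. λ=μ=t=1, k=0), so the identity is asserted only where the series converges, and this is proved to happen exactly when μt(e^{λ^α}−1)<1. *)

(* Defs.v *)
From HB Require Import structures.
From mathcomp Require Import all_boot all_order all_algebra.
From mathcomp Require Import all_classical all_reals all_analysis.

Set Implicit Arguments.
Unset Strict Implicit.
Unset Printing Implicit Defensive.

Import Order.TTheory GRing.Theory Num.Theory.
Import numFieldNormedType.Exports.

Local Open Scope classical_set_scope.
Local Open Scope ring_scope.

Section combinatorics.
Context {R : realType}.

Definition gbinom (x : R) (k : nat) : R :=
  (\prod_(i < k) (x - i%:R)) / k`!%:R.

Definition stirling2 (n k : nat) : R :=
  (k`!%:R)^-1 * \sum_(i < k.+1) (-1) ^+ i * 'C(k, i)%:R * (k - i)%:R ^+ n.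

Definition geom_poly (n : nat) : {poly R} :=
  \poly_(k < n.+1) (stirling2 n k * k`!%:R).

End combinatorics.

(* A process is a family of maps indexed by all of R, but only the times t >= 0
   matter: every condition below is restricted to them. *)
Section processes.
Context {d : measure_display} {T : measurableType d} {R : realType}
  (P : probability T R).

Definition process_sigma {d' : measure_display} {S : measurableType d'}
    (X : R -> T -> S) : set (set T) :=
  <<s \bigcup_(t in [set t : R | 0 <= t])
        preimage_set_system setT (X t) measurable >>.

Definition independent_processes {d1 d2 : measure_display}
    {S1 : measurableType d1} {S2 : measurableType d2}
    (X : R -> T -> S1) (Y : R -> T -> S2) : Prop :=
  forall A B : set T, process_sigma X A -> process_sigma Y B ->
    P (A `&` B) = (P A * P B)%E.

(* Increasing right-continuous paths are required surely, not almost surely, so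
   that time changes of processes are measurable. *)
Record increasing_paths (X : R -> T -> R) : Prop := IncreasingPaths {
  path_start : forall w, X 0 w = 0;
  path_nondecreasing : forall w (s t : R), 0 <= s -> s <= t -> X s w <= X t w;
  path_right_continuous :
    forall w (s : R), 0 <= s -> X u w @[u --> s^'+] --> X s w }.

Definition time_grid (n : nat) (u : nat -> R) : Prop :=
  0 <= u 0%N /\ forall i, (i < n)%N -> u i < u i.+1.

Definition independent_increments (X : R -> T -> R) : Prop :=
  forall (n : nat) (u : nat -> R) (A : nat -> set R),
    time_grid n u -> (forall i, measurable (A i)) ->
    P (\bigcap_(i in `I_n) [set w | A i (X (u i.+1) w - X (u i) w)]) =
    (\prod_(i < n) fine (P [set w | A i (X (u i.+1) w - X (u i) w)]))%:E.

(* Increments are only considered over intervals of positive length: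
   poisson_pmf is the constant 1 when its rate is not positive. *)
Record poisson_process (lambda : R) (N : R -> {RV P >-> nat}) : Prop :=
  PoissonProcess {
    poisson_paths : increasing_paths (fun t w => (N t w)%:R);
    poisson_increments : independent_increments (fun t w => (N t w)%:R);
    poisson_law : forall (s t : R) (k : nat), 0 <= s -> s < t ->
      P [set w | (N t w - N s w)%N = k] =
      (poisson_pmf (lambda * (t - s)) k)%:E }.

Record stable_subordinator (alpha : R) (D : R -> {RV P >-> R}) : Prop :=
  StableSubordinator {
    stable_paths : increasing_paths (fun t w => D t w);
    stable_increments : independent_increments (fun t w => D t w);
    stable_stationary : forall (s t : R) (A : set R), 0 <= s -> s <= t ->
      measurable A -> P [set w | A (D t w - D s w)] = P (D (t - s) @^-1` A);
    stable_laplace : forall s t : R, 0 <= s -> 0 <= t ->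
      'E_P[fun w => expR (- s * D t w)]%E = (expR (- t * s `^ alpha))%:E }.

(* Mixed Poisson process: given the rate x, the increments are those of a
   Poisson process of intensity x; x is then integrated out against the
   exponential law of mean mu, that is, of rate mu^-1. *)
Record geometric_counting_process (mu : R) (G : R -> {RV P >-> nat}) : Prop :=
  GeometricCountingProcess {
    geometric_paths : increasing_paths (fun t w => (G t w)%:R);
    geometric_mixed : forall (n : nat) (u : nat -> R) (k : nat -> nat),
      time_grid n u ->
      P (\bigcap_(i in `I_n) [set w | (G (u i.+1) w - G (u i) w)%N = k i]) =
      (\int[lebesgue_measure]_(x in `[0%R, +oo[)
        (exponential_pdf mu^-1 x *
         \prod_(i < n) poisson_pmf (x * (u i.+1 - u i)) (k i))%:E)%E }.

Definition space_fractional (N : R -> {RV P >-> nat}) (D : R -> {RV P >-> R})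
    (t : R) (w : T) : nat :=
  N (D t w) w.

Definition geometric_space_fractional (N : R -> {RV P >-> nat})
    (D : R -> {RV P >-> R}) (G : R -> {RV P >-> nat}) (t : R) (w : T) : nat :=
  space_fractional N D (G t w)%:R w.

End processes.

(* Main.v *)
(* Write [c = lambda ^ alpha], [y = mu t] and [q = y / (1 + y)]; [G t] is geometric
   with [P (G t = j) = (1 - q) q ^ j].

   Conditionally on [D j], [N (D j)] is Poisson of parameter [lambda * D j], so
   that [P (N (D j) = k) = E ((lambda D j) ^ k / k! * exp (- lambda D j))]; this
   is read off the [k]-th derivative of the Laplace transform
   [s |-> exp (- j s ^ alpha)], which, differentiated termwise, gives
   [sum_r binom (alpha r) k * (- c) ^ r * (- 1) ^ k / r! * j ^ r].  Averaging over
   [j] and exchanging the sums replaces [j ^ r] by the [r]-th moment of the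
   geometric law, which is [w_r y].

   As [|binom (alpha r) k|] grows slower than any exponential, the exchange is
   legitimate as soon as [q * exp c < 1], that is [y * (exp c - 1) < 1].
   Conversely [|binom (alpha r) k| >= 1] for large [r], and [c ^ r w_r y / r!] does
   not tend to [0] when [q * exp c >= 1]. *)

Require Import Defs.
From HB Require Import structures.
From mathcomp Require Import all_boot all_order all_algebra.
From mathcomp Require Import all_classical all_reals all_analysis.
From mathcomp Require Import measurable_realfun ring lra.

Set Implicit Arguments.
Unset Strict Implicit.
Unset Printing Implicit Defensive.

Import Order.TTheory GRing.Theory Num.Theory.
Import numFieldNormedType.Exports.
Local Open Scope classical_set_scope.
Local Open Scope ring_scope.

(** * Geometric polynomials *)

Section geometric_polynomials.
Context {R : realType}.

(* [k`! * stirling2 r k], the [k]-th forward difference of [x ^ r] at [0] *)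
Definition fdiff (r k : nat) : R :=
  \sum_(i < k.+1) (-1) ^+ i * 'C(k, i)%:R * (k - i)%:R ^+ r.

Lemma fdiff0 k : fdiff 0 k = (k == 0%N)%:R.
Proof.
rewrite /fdiff; have := exprBn (1 : R) 1 k; rewrite subrr expr0n => ->.
by apply: eq_bigr => i _; rewrite !expr1n expr0 !mulr1 mulr_natr.
Qed.

Lemma fdiffSn0 r : fdiff r.+1 0 = 0.
Proof. by rewrite /fdiff big_ord1 subnn expr0n mulr0. Qed.

(** Absorption, [C(k+1, i) (k+1-i) = (k+1) C(k, i)], extracts the factor [k.+1]; Pascal's rule and
    an index shift split the remaining sum. This is the Stirling recurrence scaled by factorials. *)
Lemma fdiffSS r k : fdiff r.+1 k.+1 = k.+1%:R * (fdiff r k.+1 + fdiff r k).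
Proof.
transitivity (k.+1%:R *
    \sum_(i < k.+2) (-1) ^+ i * 'C(k, i)%:R * (k.+1 - i)%:R ^+ r : R).
  rewrite /fdiff mulr_sumr; apply: eq_bigr => i _.
  have E : 'C(k.+1, i)%:R * (k.+1 - i)%:R = k.+1%:R * 'C(k, i)%:R :> R.
    by rewrite -!natrM mulnC -mul_bin_down.
  by rewrite exprS -mulrA [X in _ * X]mulrA E; ring.
congr (_ * _); rewrite /fdiff [in LHS]big_ord_recl /= [in RHS]big_ord_recl /=.
rewrite !bin0 -addrA; congr (_ + _).
rewrite -big_split /=; apply: eq_bigr => i _.
by rewrite /bump /= add1n subSS binS natrD exprS; ring.
Qed.

Lemma fdiff_small r k : (r < k)%N -> fdiff r k = 0.
Proof.
elim: r k => [|r IH] [|k]//; first by rewrite fdiff0.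
by rewrite ltnS => rk; rewrite fdiffSS !IH ?addr0 ?mulr0// ltnW.
Qed.

(** Induction on [r]: multiplication by [j] sends [C(j, k)] to [k C(j, k) + (k+1) C(j, k+1)], and
    [fdiffSS] is the matching recurrence on the coefficients. *)
Lemma expr_nat_newton (j r : nat) :
  j%:R ^+ r = \sum_(k < r.+1) fdiff r k * 'C(j, k)%:R :> R.
Proof.
elim: r => [|r IH]; first by rewrite big_ord1 fdiff0 expr0 bin0 mulr1.
have jC k : j%:R * 'C(j, k)%:R =
    k%:R * 'C(j, k)%:R + k.+1%:R * 'C(j, k.+1)%:R :> R.
  rewrite -!natrM mul_bin_left -natrD -mulnDl; have [kj|jk] := leqP k j.
    by rewrite subnKC.
  by rewrite bin_small// !muln0.
rewrite exprS IH mulr_sumr [RHS]big_ord_recl fdiffSn0 mul0r add0r /=.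
under eq_bigr do rewrite mulrCA jC mulrDr.
under [RHS]eq_bigr do rewrite /bump /= add1n fdiffSS mulrDr mulrDl.
rewrite !big_split /=; congr (_ + _); last by apply: eq_bigr => i _; ring.
rewrite big_ord_recl /= mul0r mulr0 add0r [RHS]big_ord_recr /= fdiff_small//.
by rewrite mulr0 mul0r addr0; apply: eq_bigr => i _; rewrite /bump /= add1n; ring.
Qed.

Lemma horner_geom_poly r (y : R) :
  (geom_poly r).[y] = \sum_(k < r.+1) fdiff r k * y ^+ k.
Proof.
rewrite /geom_poly horner_poly; apply: eq_bigr => k _; congr (_ * _).
by rewrite /stirling2 mulrAC mulVf ?mul1r// pnatr_eq0 -lt0n fact_gt0.
Qed.

Variable q : R.
Hypotheses (q_ge0 : 0 <= q) (q_lt1 : q < 1).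

Lemma cvg_geometric_mass : series (fun j => (1 - q) * q ^+ j) @ \oo --> (1 : R).
Proof.
have q1 : `|q| < 1 by rewrite ger0_norm.
have := @cvg_geometric_series R (1 - q) q q1.
by rewrite divff ?subr_eq0 ?gt_eqF.
Qed.

(** Binomial moments of the geometric law, by induction on [k]. Pascal's rule gives
    [v (n+1) = q u n + q v n]; as [v] is nondecreasing, [(1 - q) v n <= q u n], so [v] is bounded
    and converges, and its limit solves [l = q e + q l] with [e] the previous moment. *)
Lemma cvg_geometric_bin k :
  series (fun j => (1 - q) * q ^+ j * 'C(j, k)%:R) @ \oo --> (q / (1 - q)) ^+ k.
Proof.
have q1 : 0 < 1 - q by rewrite subr_gt0.
elim: k => [|k IH].
  rewrite expr0; under eq_fun do rewrite bin0 mulr1.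
  exact: cvg_geometric_mass.
set u := series _ in IH; set v := series _.
have v0 : v 0%N = 0 by rewrite /v seriesEnat /= big_geq.
have vS n : v n.+1 = q * u n + q * v n.
  rewrite /v /u !seriesEnat /= big_nat_recl// bin0n mulr0 add0r.
  rewrite !mulr_sumr -big_split /=; apply: eq_bigr => j _.
  by rewrite binS natrD exprS; ring.
have u_le n : u n <= (q / (1 - q)) ^+ k.
  rewrite -(cvg_lim _ IH)//; apply: nondecreasing_cvgn_le; last exact: cvgP IH.
  by apply: nondecreasing_series => i _ _; rewrite !mulr_ge0 ?exprn_ge0// ltW.
have v_ndec : nondecreasing_seq v.
  by apply: nondecreasing_series => i _ _; rewrite !mulr_ge0 ?exprn_ge0// ltW.
have v_cvg : cvgn v.
  apply: nondecreasing_is_cvgn => //.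
  exists (q * (q / (1 - q)) ^+ k / (1 - q)) => _ [n _ <-].
  rewrite ler_pdivlMr//; have := v_ndec _ _ (leqnSn n); rewrite vS.
  by have := ler_wpM2l q_ge0 (u_le n); lra.
have : v n.+1 @[n --> \oo] --> q * (q / (1 - q)) ^+ k + q * limn v.
  rewrite (_ : (fun n => v n.+1) = (fun n => q * u n + q * v n)); last exact/funext.
  by apply: cvgD; apply: cvgMl_tmp.
rewrite (cvg_shiftS v) => /cvg_lim lim_eq; have {}lim_eq := lim_eq (@Rhausdorff R).
suff <- : limn v = (q / (1 - q)) ^+ k.+1 by exact: v_cvg.
rewrite exprS mulrAC; apply: (canRL (mulfK _)); first by rewrite gt_eqF.
move: lim_eq; set l := limn v; set e := _ ^+ k => lim_eq; lra.
Qed.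

(* The geometric polynomial is the moment of a geometric law (Dobinski-type
   formula): expand [j ^ r] in Newton's basis and sum the binomials. *)
Lemma cvg_geometric_moment r :
  series (fun j => (1 - q) * q ^+ j * j%:R ^+ r) @ \oo -->
  (geom_poly r).[q / (1 - q)].
Proof.
rewrite horner_geom_poly.
rewrite (_ : series _ = (fun n => \sum_(k < r.+1)
    fdiff r k * series (fun j => (1 - q) * q ^+ j * 'C(j, k)%:R) n)).
  apply: cvg_big => [|k _]; first exact: add_continuous.
  by apply: cvgMl_tmp; exact: cvg_geometric_bin.
apply/funext => n; rewrite seriesEnat /=.
under [RHS]eq_bigr do rewrite seriesEnat /= mulr_sumr.
rewrite [RHS]exchange_big /=; apply: eq_bigr => j _.
rewrite expr_nat_newton mulr_sumr; apply: eq_bigr => k _; ring.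
Qed.

Lemma geom_poly_ge r J :
  \sum_(0 <= j < J) (1 - q) * q ^+ j * j%:R ^+ r <= (geom_poly r).[q / (1 - q)].
Proof.
have cv := @cvg_geometric_moment r; rewrite -(cvg_lim _ cv)//.
apply: (nondecreasing_cvgn_le _ (cvgP _ cv)).
apply: nondecreasing_series => i _ _.
by rewrite !mulr_ge0 ?exprn_ge0// subr_ge0 ltW.
Qed.

Lemma geom_poly_ge0 r : 0 <= (geom_poly r).[q / (1 - q)].
Proof. by have := geom_poly_ge r 0; rewrite big_geq. Qed.

End geometric_polynomials.

(** * Series of geometric polynomials *)

Section real_series.
Context {R : realType}.
Implicit Types x : R.

Lemma exp_coeff_le x n : 0 <= x -> x ^+ n / n`!%:R <= expR x.
Proof.
move=> x0; case: n => [|n].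
  rewrite expr0 fact0 divr1 -[leLHS]addr0; apply: le_trans (expR_ge1Dx _).
  by rewrite lerD2l.
by apply: le_trans (expR_ge1Dxn n x0); rewrite lerDr.
Qed.

Lemma cvg_expR_series x : series (fun r => x ^+ r / r`!%:R) @ \oo --> expR x.
Proof. exact: is_cvg_series_exp_coeff. Qed.

Lemma exp_series_le x n : 0 <= x -> \sum_(0 <= r < n) x ^+ r / r`!%:R <= expR x.
Proof.
move=> x0; have cv := @cvg_expR_series x; rewrite -(cvg_lim _ cv)//.
apply: (nondecreasing_cvgn_le _ (cvgP _ cv)).
by apply: nondecreasing_series => i _ _; rewrite divr_ge0// exprn_ge0.
Qed.

Lemma geometric_sum_le x n : 0 <= x -> x < 1 ->
  \sum_(0 <= r < n) x ^+ r <= (1 - x)^-1.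
Proof.
move=> x0 x1; have nx : `|x| < 1 by rewrite ger0_norm.
have := @cvg_geometric_series R 1 x nx; rewrite mul1r => cx.
rewrite -(cvg_lim _ cx)//; under eq_bigr do rewrite -[_ ^+ _]mul1r.
apply: (nondecreasing_cvgn_le _ (cvgP _ cx)).
by apply: nondecreasing_series => i _ _; rewrite /= mul1r exprn_ge0.
Qed.

Lemma cvg_limr_le (u : R^nat) (l M : R) :
  u @ \oo --> l -> (forall n, u n <= M) -> l <= M.
Proof.
move=> ul uM; rewrite -(cvg_lim _ ul)//; apply: limr_le; first exact: cvgP ul.
exact: nearW.
Qed.

Lemma cvg_limr_norm_le (u : R^nat) (l M : R) :
  u @ \oo --> l -> (\forall n \near \oo, `|u n| <= M) -> `|l| <= M.
Proof.
move=> /cvg_norm ul uM; rewrite -(cvg_lim _ ul)//.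
by apply: limr_le => //; exact: cvgP ul.
Qed.

Lemma cvg_squeeze0 (u v : R^nat) (l : R) :
  v @ \oo --> (0 : R) -> (forall n, `|l - u n| <= v n) -> u @ \oo --> l.
Proof.
move=> v0 uv; apply/subr_cvg0/norm_cvg0P.
apply: (@squeeze_cvgr _ _ _ _ (cst 0) v); last exact: v0.
- by apply: nearW => n; rewrite normr_ge0 /= distrC.
- exact: cvg_cst.
Qed.

End real_series.

(** * Growth of the generalised binomial coefficients *)

Section coefficients.
Context {R : realType} (alpha : R) (k : nat).
Hypotheses (alpha_gt0 : 0 < alpha) (alpha_lt1 : alpha < 1).

(** Each factor satisfies [|alpha r - i| <= r + k], and [x ^ k / k! <= exp x] is applied at
    [x = delta (r + k)]. As [delta] is arbitrary, the growth in [r] is subexponential. *)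
Lemma normr_gbinom_le (delta : R) r : 0 < delta ->
  `|gbinom (alpha * r%:R) k| <=
  expR (delta * k%:R) / delta ^+ k * expR delta ^+ r.
Proof.
move=> delta_gt0; rewrite /gbinom normrM normfV [`|_`!%:R|]ger0_norm//.
have -> : expR (delta * k%:R) / delta ^+ k * expR delta ^+ r =
    expR (delta * (r + k)%:R) / delta ^+ k.
  by rewrite -expRM_natr mulrAC -expRD natrD mulrDr addrC.
rewrite ler_pdivlMr ?exprn_gt0//.
apply: le_trans (exp_coeff_le k _); last by rewrite mulr_ge0// ltW.
rewrite exprMn [leLHS]mulrAC ler_wpM2r ?invr_ge0//.
rewrite [leLHS]mulrC ler_wpM2l ?exprn_ge0 ?(ltW delta_gt0)//.
have -> : (r + k)%:R ^+ k = \prod_(i < k) (r + k)%:R :> R.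
  by rewrite prodr_const card_ord.
rewrite normr_prod; apply: ler_prod => i _; rewrite normr_ge0 /=.
apply: le_trans (ler_normB _ _) _.
rewrite ger0_norm ?mulr_ge0 ?(ltW alpha_gt0)// ger0_norm// natrD.
by rewrite lerD ?ler_nat ?(ltnW (ltn_ord i))// ler_piMl// ltW.
Qed.

(** The factors [x - i] dominate the factors [k - i], whose product is [k!]. *)
Lemma gbinom_ge1 (x : R) : k%:R <= x -> 1 <= gbinom x k.
Proof.
move=> kx; rewrite /gbinom ler_pdivlMr ?ltr0n ?fact_gt0// mul1r.
rewrite -ffactnn ffact_prod natr_prod; apply: ler_prod => i _.
by rewrite ler0n /= natrB ?(ltnW (ltn_ord i))// lerB.
Qed.

End coefficients.

(** * Divergence and convergence of the series of geometric polynomials *)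

Section geometric_polynomial_series.
Context {R : realType}.
Variables (alpha c q : R) (k : nat).
Hypotheses (alpha_gt0 : 0 < alpha) (alpha_lt1 : alpha < 1).
Hypotheses (c_gt0 : 0 < c) (q_ge0 : 0 <= q) (q_lt1 : q < 1).

Let w r := (geom_poly r).[q / (1 - q)].

(* Abel's argument: [sum_r x ^ r u_r = (1 - q) / (1 - q * exp (c * x))] blows up
   at least like [(1 - q) / (c * (1 - x))] as [x] tends to [1], which is
   incompatible with [u_r --> 0]. *)
Lemma geom_poly_exp_not_cvg0 : 1 <= q * expR c ->
  ~ (fun r => c ^+ r / r`!%:R * w r) @ \oo --> (0 : R).
Proof.
move=> qc; set u := (fun r => _) => u0.
have q1 : 0 < 1 - q by rewrite subr_gt0.
have w0 r : 0 <= w r by exact: geom_poly_ge0.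
have u_ge0 r : 0 <= u r by rewrite /u mulr_ge0// divr_ge0// exprn_ge0// ltW.
(* The blow-up constant [(1 - q) / c] equals [3 * eps], whereas the upper bound [K + eps / h],
   multiplied by [h], will be at most [2 * eps]. *)
pose eps := (1 - q) / (3 * c).
have eps_gt0 : 0 < eps by rewrite divr_gt0// mulr_gt0.
have /cvgrPdist_le/(_ _ eps_gt0) [r0 _ ur0] := u0.
have {}ur0 r : (r0 <= r)%N -> u r <= eps.
  by move/ur0; rewrite /= sub0r normrN ger0_norm.
pose K : R := \sum_(0 <= r < r0) u r.
have K_ge0 : 0 <= K by apply: sumr_ge0.
(* [h <= 1/2] keeps [x = 1 - h] positive, and the second bound gives [K * h <= eps]; the [+ 1]
   avoids a zero divisor. *)
pose h := Num.min 2^-1 (eps / (K + 1)).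
have h_gt0 : 0 < h by rewrite lt_min invr_gt0 ltr0n /= divr_gt0// ltr_wpDl.
have h_lt1 : h < 1 by rewrite gt_min invf_lt1 ?ltr1n.
have Kh : K * h <= eps.
  apply: (@le_trans _ _ ((K + 1) * h)).
    by rewrite ler_wpM2r ?(ltW h_gt0)// lerDl.
  by rewrite mulrC -ler_pdivlMr ?ltr_wpDl// ge_min lexx orbT.
pose x := 1 - h.
have x_gt0 : 0 < x by rewrite subr_gt0.
have x_lt1 : x < 1 by rewrite /x; lra.
have upper n : \sum_(0 <= r < n) x ^+ r * u r <= K + eps / h.
  apply: (@le_trans _ _ (\sum_(0 <= r < r0 + n) x ^+ r * u r)).
    rewrite [leRHS](@big_cat_nat _ _ _ n)//= ?leq_addl//.
    by rewrite lerDl sumr_ge0// => i _; rewrite mulr_ge0// exprn_ge0// ltW.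
  rewrite (@big_cat_nat _ _ _ r0)//= ?leq_addr//; apply: lerD.
    by apply: ler_sum => r _; rewrite ler_piMl// exprn_ile1// ltW.
  apply: (@le_trans _ _ (\sum_(r0 <= r < r0 + n) eps * x ^+ r)).
    rewrite big_nat_cond [leRHS]big_nat_cond.
    apply: ler_sum => r /andP[/andP[r0r _] _].
    by rewrite mulrC ler_wpM2r ?ur0// exprn_ge0// ltW.
  rewrite -mulr_sumr ler_wpM2l ?(ltW eps_gt0)//.
  apply: (@le_trans _ _ (\sum_(0 <= r < r0 + n) x ^+ r)).
    rewrite [leRHS](@big_cat_nat _ _ _ r0)//= ?leq_addr// lerDr sumr_ge0// => i _.
    by rewrite exprn_ge0// ltW.
  have -> : h = 1 - x by rewrite /x; lra.
  exact: geometric_sum_le (ltW x_gt0) x_lt1.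
(* From [1 <= q * exp c] follows [exp (- c h) <= q * exp (c x)]; expanding [exp (c x j)] and
   exchanging finite sums reduces the claim to [upper]. *)
have lower J : \sum_(0 <= j < J) (1 - q) * expR (- (c * h)) ^+ j <= K + eps / h.
  apply: (@le_trans _ _ (\sum_(0 <= j < J) (1 - q) * q ^+ j * expR (c * x * j%:R))).
    apply: ler_sum => j _; rewrite -mulrA ler_wpM2l ?(ltW q1)//.
    rewrite expRM_natr -exprMn lerXn2r ?nnegrE ?expR_ge0 ?mulr_ge0 ?expR_ge0//.
    rewrite -(ler_pM2r (expR_gt0 (c * h))) -expRD addNr expR0 -mulrA -expRD.
    by rewrite -mulrDr /x subrK mulr1.
  apply: (@cvg_limr_le _ (fun n => \sum_(0 <= j < J) (1 - q) * q ^+ j *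
      series (fun r => (c * x * j%:R) ^+ r / r`!%:R) n)).
    apply: cvg_big => [|j _]; first exact: add_continuous.
    by apply: cvgMl_tmp; exact: cvg_expR_series.
  move=> n; apply: le_trans (upper n).
  under eq_bigr do rewrite seriesEnat /= mulr_sumr.
  rewrite exchange_big /=; apply: ler_sum => r _.
  apply: (@le_trans _ _ (x ^+ r * (c ^+ r / r`!%:R) *
      \sum_(0 <= j < J) (1 - q) * q ^+ j * j%:R ^+ r)).
    rewrite mulr_sumr; apply: ler_sum => j _.
    by rewrite !exprMn le_eqVlt; apply/orP; left; apply/eqP; ring.
  rewrite /u [leRHS]mulrA ler_wpM2l ?geom_poly_ge//.
  by rewrite !mulr_ge0 ?invr_ge0 ?exprn_ge0// ltW.
have ch : 0 < c * h by rewrite mulr_gt0.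
have e1 : expR (- (c * h)) < 1 by rewrite expR_lt1 oppr_lt0.
have e1' : 0 < 1 - expR (- (c * h)) by rewrite subr_gt0.
have lim_le : (1 - q) / (1 - expR (- (c * h))) <= K + eps / h.
  apply: cvg_limr_le lower.
  by apply: cvg_geometric_series; rewrite ger0_norm ?expR_ge0.
have : (1 - q) / (c * h) <= K + eps / h.
  apply: le_trans lim_le; rewrite ler_wpM2l ?(ltW q1)// lef_pV2 ?posrE//.
  by have := expR_ge1Dx (- (c * h)); lra.
rewrite invfM mulrA ler_pdivrMr// [leRHS]mulrDl divfK ?gt_eqF//.
have -> : (1 - q) / c = 3 * eps by rewrite /eps; field; rewrite gt_eqF.
lra.
Qed.

Let a r := gbinom (alpha * r%:R) k * ((- c) ^+ r * (-1) ^+ k / r`!%:R) * w r.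

(** Once [k <= alpha r] the binomial is at least [1], so [|a r|] dominates [c ^ r / r! * w r]; the
    terms of a convergent series would force the latter to [0]. *)
Lemma geom_poly_series_dvg : 1 <= q * expR c -> ~ cvgn (series a).
Proof.
move=> qc /cvg_series_cvg_0 a0; apply: (geom_poly_exp_not_cvg0 qc).
have {}a0 : `|a r| @[r --> \oo] --> (0 : R).
  by rewrite -(@normr0 _ R); exact: cvg_norm a0.
apply: (@squeeze_cvgr _ _ _ _ (cst 0) _ _ _ _ _ a0); last exact: cvg_cst.
near=> r.
have r_big : k%:R <= alpha * r%:R.
  by rewrite mulrC -ler_pdivrMr//; near: r; exact: nbhs_infty_ger.
have u_ge0 : 0 <= c ^+ r / r`!%:R * w r.
  by rewrite mulr_ge0 ?geom_poly_ge0// divr_ge0// exprn_ge0// ltW.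
rewrite /= u_ge0 /= /a; move: (gbinom_ge1 r_big); move: (gbinom _ _) => g g1.
rewrite !normrM !normrX !normrN normr1 expr1n mulr1 normfV.
rewrite [`|c|]gtr0_norm// [`|w r|]ger0_norm ?geom_poly_ge0//.
by rewrite normr_nat -[leRHS]mulrA ler_peMl// (le_trans g1) ?ler_norm.
Unshelve. all: by end_near. Qed.

Let coef r := gbinom (alpha * r%:R) k * ((- c) ^+ r * (-1) ^+ k / r`!%:R).

Variables (p : nat -> R) (l : R).
Hypothesis p_series : forall j, series (fun r => coef r * j%:R ^+ r) @ \oo --> p j.
Hypothesis l_series : series (fun j => (1 - q) * q ^+ j * p j) @ \oo --> l.

(** Quantitative exchange of sums: the remainder of the series of [p j] after [n] terms is at most
    [C * exp (- delta n) * b ^ j], which has finite geometric mean because [q * b < 1]. The error on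
    [l] is therefore exponentially small in [n]. *)
Lemma geom_poly_series_cvg : q * expR c < 1 -> series a @ \oo --> l.
Proof.
move=> qc.
(* The strict inequality survives a small perturbation. Of the two factors [exp delta], one absorbs
   the growth of the binomials, the other produces the decay of the remainders. *)
have [delta delta_gt0 qd] : exists2 d : R, 0 < d & q * expR (c * expR (2 * d)) < 1.
  have cont : (fun d : R => q * expR (c * expR (2 * d))) @ 0^'+ --> q * expR c.
    rewrite -[X in _ --> _ * expR X]mulr1 -[X in _ --> _ * expR (_ * X)]expR0.
    rewrite -[X in _ --> _ * expR (_ * expR X)](mulr0 2).
    apply: cvg_at_right_filter.
    apply: cvgMl_tmp; apply: (continuous_cvg _ (@continuous_expR R _)).
    apply: cvgMl_tmp; apply: (continuous_cvg _ (@continuous_expR R _)).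
    by apply: cvgMl_tmp; exact: cvg_id.
  near (0 : R)^'+ => d; exists d; first by near: d; exact: nbhs_right_gt.
  by near: d; exact: (cvgr_lt _ cont).
pose C := expR (delta * k%:R) / delta ^+ k.
have C_ge0 : 0 <= C by rewrite divr_ge0 ?expR_ge0 ?exprn_ge0// ltW.
pose b := expR (c * expR (2 * delta)).
have b_gt0 : 0 < b by exact: expR_gt0.
have coef_le r : `|coef r| <= C * ((c * expR delta) ^+ r / r`!%:R).
  have := normr_gbinom_le k alpha_gt0 alpha_lt1 r delta_gt0; rewrite /coef -/C.
  move: (gbinom _ _) => g g_le.
  rewrite !normrM !normrX !normrN normr1 expr1n mulr1 normfV.
  rewrite [`|c|]gtr0_norm// normr_nat exprMn.
  apply: (@le_trans _ _ (C * expR delta ^+ r * (c ^+ r / r`!%:R))).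
    by rewrite ler_wpM2r// divr_ge0// exprn_ge0// ltW.
  by rewrite le_eqVlt; apply/orP; left; apply/eqP; ring.
clearbody C.
(* For [r >= n] one inserts [1 <= exp (- delta) ^ n * exp delta ^ r]; what is left is part of the
   exponential series of [b ^ j]. *)
have tail j n : `|p j - \sum_(0 <= r < n) coef r * j%:R ^+ r| <=
    C * expR (- delta) ^+ n * b ^+ j.
  have := @p_series j; set s := series _ => /(cvgB (cvg_cst (s n))).
  have -> : \sum_(0 <= r < n) coef r * j%:R ^+ r = s n by rewrite /s seriesEnat.
  move=> /cvg_limr_norm_le ps; rewrite distrC; apply: ps.
  near=> m; have nm : (n <= m)%N by near: m; exact: nbhs_infty_ge.
  rewrite /= distrC sub_series_geq//.
  apply: le_trans (ler_norm_sum _ _ _) _.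
  have -> : b ^+ j = expR (c * expR (2 * delta) * j%:R) by rewrite expRM_natr.
  apply: (@le_trans _ _ (C * expR (- delta) ^+ n *
      \sum_(0 <= r < m) (c * expR (2 * delta) * j%:R) ^+ r / r`!%:R)); last first.
    apply: ler_wpM2l; first by rewrite mulr_ge0 ?exprn_ge0 ?expR_ge0.
    by apply: exp_series_le; rewrite !mulr_ge0 ?expR_ge0 ?(ltW c_gt0).
  rewrite [in leRHS](@big_cat_nat _ _ _ n)//= mulrDr -[leLHS]add0r.
  have nonneg r : 0 <= (c * expR (2 * delta) * j%:R) ^+ r / r`!%:R.
    by rewrite divr_ge0 ?exprn_ge0 ?mulr_ge0 ?expR_ge0 ?(ltW c_gt0).
  apply: lerD; first by rewrite mulr_ge0 ?sumr_ge0// mulr_ge0 ?exprn_ge0 ?expR_ge0.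
  rewrite mulr_sumr big_nat_cond [leRHS]big_nat_cond.
  apply: ler_sum => r /andP[/andP[nr _] _].
  rewrite normrM normrX [`|j%:R|]ger0_norm//.
  apply: le_trans (ler_wpM2r _ (coef_le r)) _; first by rewrite exprn_ge0.
  rewrite -!mulrA ler_wpM2l// !exprMn.
  have -> : expR (2 * delta) ^+ r = expR delta ^+ r * expR delta ^+ r.
    by rewrite -exprMn -expRD; congr (expR _ ^+ _); lra.
  apply: (@le_trans _ _ (expR (- delta) ^+ n * expR delta ^+ r *
     (c ^+ r * expR delta ^+ r / r`!%:R * j%:R ^+ r))); last first.
    by rewrite le_eqVlt; apply/orP; left; apply/eqP; ring.
  apply: (@le_trans _ _ (1 * (c ^+ r * expR delta ^+ r / r`!%:R * j%:R ^+ r))).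
    by rewrite le_eqVlt; apply/orP; left; apply/eqP; ring.
  apply: ler_wpM2r.
    by rewrite !mulr_ge0 ?invr_ge0 ?exprn_ge0 ?expR_ge0 ?(ltW c_gt0).
  rewrite -(subnKC nr) exprD mulrA -exprMn -expRD addNr expR0 expr1n mul1r.
  by rewrite exprn_ege1// -expR0 ler_expR ltW.
have q1 : 0 < 1 - q by rewrite subr_gt0.
have qb0 : 0 <= q * b by rewrite mulr_ge0// ltW.
apply: (@cvg_squeeze0 _ _
  (fun n => C * ((1 - q) / (1 - q * b)) * expR (- delta) ^+ n)).
  rewrite -[X in _ --> X](mulr0 (C * ((1 - q) / (1 - q * b)))).
  apply: cvgMl_tmp; apply: cvg_expr.
  by rewrite ger0_norm ?expR_ge0// expR_lt1 oppr_lt0.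
move=> n.
(* A partial sum of [a] is the geometric mean over [j] of the truncated series, by exchanging a
   finite sum with the moments [cvg_geometric_moment]. *)
have an : series (fun j => (1 - q) * q ^+ j *
    \sum_(0 <= r < n) coef r * j%:R ^+ r) @ \oo --> series a n.
  rewrite (_ : series _ = (fun m => \sum_(0 <= r < n)
      coef r * series (fun j => (1 - q) * q ^+ j * j%:R ^+ r) m)).
    rewrite seriesEnat; apply: cvg_big => [|r _]; first exact: add_continuous.
    by apply: cvgMl_tmp; exact: cvg_geometric_moment.
  apply/funext => m; rewrite seriesEnat /=.
  under [RHS]eq_bigr do rewrite seriesEnat /= mulr_sumr.
  rewrite [RHS]exchange_big /=; apply: eq_bigr => j _.
  by rewrite mulr_sumr; apply: eq_bigr => r _; ring.
apply: (cvg_limr_norm_le (cvgB l_series an)).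
apply: nearW => m; rewrite !seriesEnat !fctE -sumrB.
apply: le_trans (ler_norm_sum _ _ _) _.
apply: (@le_trans _ _ (\sum_(0 <= j < m)
    C * (1 - q) * expR (- delta) ^+ n * (q * b) ^+ j)).
  apply: ler_sum => j _; rewrite -mulrBr normrM ger0_norm; last first.
    by rewrite mulr_ge0 ?exprn_ge0// ltW.
  apply: le_trans (ler_wpM2l _ (tail j n)) _.
    by rewrite mulr_ge0 ?exprn_ge0// ltW.
  by rewrite exprMn le_eqVlt; apply/orP; left; apply/eqP; ring.
rewrite -mulr_sumr.
have -> : C * ((1 - q) / (1 - q * b)) * expR (- delta) ^+ n =
  C * (1 - q) * expR (- delta) ^+ n * (1 - q * b)^-1 by ring.
rewrite ler_wpM2l ?mulr_ge0 ?exprn_ge0 ?expR_ge0 ?(ltW q1)//.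
exact: geometric_sum_le.
Unshelve. all: by end_near. Qed.

End geometric_polynomial_series.

(** * Derivatives of the stretched exponential *)

Section entire_power_series.
Context {R : realType}.
Implicit Type f : R^nat.

(** Coefficients of an entire function of exponential type; [CA] packs the constant and the rate.
    The class is stable under termwise differentiation, so one bound yields the convergence of the
    series and of its first two derivatives. *)
Definition exp_dominated f :=
  exists CA : R * R, 0 <= CA.2 /\ forall r, `|f r| <= CA.1 * (CA.2 ^+ r / r`!%:R).

Lemma exp_dominated_cvg f z : exp_dominated f -> cvgn (pseries f z).
Proof.
move=> [[C A] /= [A0 fCA]]; apply: normed_cvg.
apply: (@series_le_cvg _ _ (fun r => C * ((A * `|z|) ^+ r / r`!%:R))).
- by move=> r; exact: normr_ge0.
- move=> r; apply: le_trans (normr_ge0 (f r * z ^+ r)) _.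
  rewrite normrM normrX exprMn; apply: le_trans (ler_wpM2r _ (fCA r)) _.
    by rewrite exprn_ge0.
  by rewrite le_eqVlt; apply/orP; left; apply/eqP; ring.
- move=> r /=; rewrite normrM normrX exprMn; apply: le_trans (ler_wpM2r _ (fCA r)) _.
    by rewrite exprn_ge0.
  by rewrite le_eqVlt; apply/orP; left; apply/eqP; ring.
- by apply: is_cvg_seriesZ; exact: (cvgP _ (@cvg_expR_series _ _)).
Qed.

Lemma exp_dominated_diffs f : exp_dominated f -> exp_dominated (pseries_diffs f).
Proof.
move=> [[C A] /= [A0 fCA]]; exists (C * A, A); split => // r /=.
rewrite /pseries_diffs normrM ger0_norm//.
apply: le_trans (ler_wpM2l _ (fCA r.+1)) _ => //.
rewrite factS natrM exprS le_eqVlt; apply/orP; left; apply/eqP; field.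
by rewrite nat1r !pnatr_eq0 -lt0n fact_gt0.
Qed.

Lemma exp_dominated_is_derive f z : exp_dominated f ->
  is_derive z (1 : R) (fun x => limn (pseries f x))
    (limn (pseries (pseries_diffs f) z)).
Proof.
move=> fd; apply: (@pseries_snd_diffs _ _ (`|z| + 1)).
- exact: exp_dominated_cvg.
- by apply: exp_dominated_cvg; exact: exp_dominated_diffs.
- by apply: exp_dominated_cvg; do 2 apply: exp_dominated_diffs.
- by rewrite [ltRHS]ger0_norm ?addr_ge0// ltrDl.
Qed.

End entire_power_series.

Section stretched_exponential.
Context {R : realType}.
Variables (alpha tau : R).
Hypotheses (alpha_gt0 : 0 < alpha) (alpha_lt1 : alpha < 1) (tau_ge0 : 0 <= tau).

(** Coefficient of [(s ^ alpha) ^ r] in [s ^ k] times the [k]-th derivative of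
    [exp (- tau s ^ alpha)]: differentiating [s ^ (alpha r)] brings out a falling factorial. *)
Definition stretched_coef k r : R :=
  \prod_(i < k) (alpha * r%:R - i%:R) * ((- tau) ^+ r / r`!%:R).
Let cf := stretched_coef.
Let F k z : R := limn (pseries (cf k) z).

Lemma exp_dominated_stretched_coef k : exp_dominated (stretched_coef k).
Proof.
exists (k`!%:R * (expR (1 * k%:R) / 1 ^+ k), expR 1 * tau); split => [|r] /=.
  by rewrite mulr_ge0 ?expR_ge0.
have -> : stretched_coef k r =
    k`!%:R * (gbinom (alpha * r%:R) k * ((- tau) ^+ r / r`!%:R)).
  rewrite /stretched_coef /gbinom; field.
  by rewrite !pnatr_eq0 -!lt0n !fact_gt0.
have := normr_gbinom_le k alpha_gt0 alpha_lt1 r (@ltr01 R).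
move: (gbinom _ _) (_ / 1 ^+ k) => g C /(ler_wpM2r _) gC.
rewrite !normrM !normrX normrN normfV !normr_nat (ger0_norm tau_ge0).
rewrite -mulrA ler_wpM2l//; apply: le_trans (gC (tau ^+ r / r`!%:R) _) _.
  by rewrite divr_ge0 ?exprn_ge0.
by rewrite exprMn le_eqVlt; apply/orP; left; apply/eqP; ring.
Qed.

(** Passing from [k] to [k.+1] multiplies the coefficient by [alpha r - k], and a factor [r] acts on
    the series as [z d/dz]. *)
Let F_rec k z :
  F k.+1 z = alpha * z * limn (pseries (pseries_diffs (cf k)) z) - k%:R * F k z.
Proof.
have cdiff : cvgn (pseries (pseries_diffs (cf k)) z).
  apply: exp_dominated_cvg; apply: exp_dominated_diffs.
  exact: exp_dominated_stretched_coef.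
have ck : cvgn (pseries (cf k) z).
  by apply: exp_dominated_cvg; exact: exp_dominated_stretched_coef.
have lim := cvgB (@cvgMl_tmp _ _ _ _ _ (alpha * z) _ (pseries_diffs_equiv cdiff))
  (@cvgMl_tmp _ _ _ _ _ k%:R _ ck).
rewrite {1}/F (_ : pseries (cf k.+1) z = (fun n =>
    alpha * z * series (fun i => i%:R * cf k i * z ^+ i.-1) n -
    k%:R * pseries (cf k) z n)); first by apply/cvg_lim => //; exact: lim.
apply/funext => n.
rewrite /pseries !seriesEnat /= !mulr_sumr -sumrB; apply: eq_bigr => r _.
rewrite /cf /stretched_coef big_ord_recr /=.
case: r => [|r]; first by rewrite expr0; ring.
by rewrite /= (exprS z); ring.
Qed.

(* for [0 < s], the [k]-th derivative of [fun s => expR (- tau * s `^ alpha)],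
   whose power series in [s `^ alpha] is differentiated termwise *)
Definition stretched_exp_deriv k (s : R) : R :=
  s `^ (- k%:R) * limn (pseries (stretched_coef k) (s `^ alpha)).

(** The product and chain rules on [s ^ (- k) * F k (s ^ alpha)] give two terms, which [F_rec]
    reassembles into [F k.+1]. *)
Lemma stretched_exp_deriv_is_derive k (s : R) : 0 < s ->
  is_derive s (1 : R) (stretched_exp_deriv k) (stretched_exp_deriv k.+1 s).
Proof.
move=> s0.
have dF := exp_dominated_is_derive (s `^ alpha) (exp_dominated_stretched_coef k).
have dp := is_derive1_powR alpha s0.
have dk := is_derive1_powR (- k%:R) s0.
have dc := @is_derive1_comp R (F k) (fun x => x `^ alpha) s _ _ dF dp.
apply: is_derive_eq (is_deriveM dk dc) _.
rewrite /stretched_exp_deriv -/(F _ _) F_rec /= -/(F _ _) /GRing.scale /=.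
set F' := limn _; set Fk := F _ _.
have -> : - k.+1%:R = - k%:R - 1 :> R by rewrite -addn1 natrD opprD.
have E : s `^ (- k%:R) * s `^ (alpha - 1) = s `^ (- k%:R - 1) * s `^ alpha.
  by rewrite -!powRD ?(gt_eqF s0) ?implybT//; congr (_ `^ _); ring.
transitivity (alpha * F' * (s `^ (- k%:R) * s `^ (alpha - 1)) -
    k%:R * Fk * s `^ (- k%:R - 1)); first by ring.
by rewrite E; ring.
Qed.

Lemma stretched_exp_deriv0 s : 0 < s ->
  stretched_exp_deriv 0 s = expR (- tau * s `^ alpha).
Proof.
move=> s0; rewrite /stretched_exp_deriv oppr0 powRr0 mul1r.
rewrite expRE (_ : pseries (stretched_coef 0) (s `^ alpha) =
  pseries (fun n => n`!%:R^-1) (- tau * s `^ alpha))//.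
apply/funext => n; rewrite /pseries !seriesEnat /=; apply: eq_bigr => r _.
by rewrite /stretched_coef big_ord0 exprMn; ring.
Qed.

(** The prefactor [s ^ k] cancels [s ^ (- k)], and the powers of [tau] and [s ^ alpha] trade places
    between coefficient and variable. *)
Lemma cvg_stretched_exp_deriv k s : 0 < s ->
  series (fun r => gbinom (alpha * r%:R) k *
      ((- (s `^ alpha)) ^+ r * (-1) ^+ k / r`!%:R) * tau ^+ r) @ \oo -->
  s ^+ k / k`!%:R * ((-1) ^+ k * stretched_exp_deriv k s).
Proof.
move=> s0; rewrite /stretched_exp_deriv.
have -> : s ^+ k / k`!%:R * ((-1) ^+ k * (s `^ (- k%:R) *
    limn (pseries (stretched_coef k) (s `^ alpha)))) =
  (-1) ^+ k / k`!%:R * limn (pseries (stretched_coef k) (s `^ alpha)).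
  have E : s ^+ k * s `^ (- k%:R) = 1.
    by rewrite -powR_mulrn ?ltW// powRN divff// powR_eq0 gt_eqF.
  move: (limn _) => l.
  transitivity ((s ^+ k * s `^ (- k%:R)) * ((-1) ^+ k / k`!%:R * l)); first by ring.
  by rewrite E mul1r.
rewrite (_ : series _ = (fun n => (-1) ^+ k / k`!%:R *
    pseries (stretched_coef k) (s `^ alpha) n)).
  apply: cvgMl_tmp; exact: exp_dominated_cvg (@exp_dominated_stretched_coef k).
apply/funext => n; rewrite /pseries !seriesEnat /= mulr_sumr; apply: eq_bigr => r _.
rewrite /gbinom /stretched_coef -[- (s `^ alpha)]mulN1r -[- tau]mulN1r !exprMn.
by ring.
Qed.

End stretched_exponential.

(** * Derivatives of the Laplace transform of a nonnegative random variable *)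

Section exponential_moments.
Context {d : measure_display} {T : measurableType d} {R : realType}
  (P : probability T R).

Lemma bounded_integrable (f : T -> R) (C : R) : measurable_fun setT f ->
  (forall w, `|f w| <= C) -> P.-integrable setT (EFin \o f).
Proof.
move=> mf fC; apply: measurable_bounded_integrable => //.
  by rewrite -ge0_fin_numE ?fin_num_measure.
by exists C; split => [|M CM w _ /=]; [exact: num_real|exact: le_trans (ltW CM)].
Qed.

Variable X : T -> R.
Hypotheses (mX : measurable_fun setT X) (X_ge0 : forall w, 0 <= X w).

(** Up to the sign [(-1) ^ k], the [k]-th derivative of the Laplace transform of [X]. *)
Definition exp_moment k (s : R) : R := \int[P]_w (X w ^+ k * expR (- s * X w)).

Lemma measurable_exp_moment k s :
  measurable_fun setT (fun w => X w ^+ k * expR (- s * X w)).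
Proof.
apply: measurable_funM; first exact: measurable_funX.
by apply: measurableT_comp => //; exact: measurable_funM.
Qed.

Lemma exp_moment_bound k (s x : R) : 0 < s -> 0 <= x ->
  x ^+ k * expR (- s * x) <= k`!%:R / s ^+ k.
Proof.
move=> s0 x0; rewrite ler_pdivlMr ?exprn_gt0// mulNr expRN mulrAC.
rewrite ler_pdivrMr ?expR_gt0// -exprMn [x * s]mulrC [leRHS]mulrC.
rewrite -ler_pdivrMr ?ltr0n ?fact_gt0//.
by apply: exp_coeff_le; rewrite mulr_ge0// ltW.
Qed.

Lemma integrable_exp_moment k s : 0 < s ->
  P.-integrable setT (EFin \o (fun w => X w ^+ k * expR (- s * X w))).
Proof.
move=> s0; apply: (@bounded_integrable _ (k`!%:R / s ^+ k)).
  exact: measurable_exp_moment.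
move=> w; rewrite ger0_norm; first exact: exp_moment_bound.
by rewrite mulr_ge0 ?expR_ge0 ?exprn_ge0.
Qed.

Lemma exp_moment_is_derive k (s : R) : 0 < s ->
  is_derive s (1 : R) (exp_moment k) (- exp_moment k.+1 s).
Proof.
move=> s0; pose f (x : R) w := X w ^+ k * expR (- x * X w).
have df x w : is_derive x (1 : R) (f ^~ w) (- (X w ^+ k.+1 * expR (- x * X w))).
  have d1 : is_derive x (1 : R) (fun x => - x * X w) (- X w).
    rewrite (_ : (fun x => _) = (- X w) *: (@id R)); last first.
      by apply/funext => z; rewrite /= fctE /GRing.scale /= mulNr mulrC mulNr.
    by apply: is_derive_eq (is_deriveZ _ (is_derive_id _ _)) _; exact: mulr1.
  have d2 := @is_derive1_comp _ expR (fun x => - x * X w) x _ _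
    (is_derive_expR _) d1.
  by apply: is_derive_eq (is_deriveZ _ d2) _; rewrite /GRing.scale /= exprS; ring.
have p1 x w : partial1of2 f x w = - (X w ^+ k.+1 * expR (- x * X w)).
  by rewrite partial1of2E; have [_] := df x w.
(* On []s / 2, s + 1[] the derivative of the integrand is dominated by the constant that
   [exp_moment_bound] gives at [s / 2]. *)
pose G (w : T) : R := k.+1`!%:R / (s / 2) ^+ k.+1.
have s2 : 0 < s / 2 by rewrite divr_gt0.
have Is : s \in `]s / 2, s + 1[.
  by rewrite in_itv /= ltr_pdivrMr// ltr_pMr// ltr1n ltrDl ltr01.
have pos x : x \in `]s / 2, s + 1[ -> 0 < x.
  by rewrite in_itv /= => /andP[/(lt_trans s2)].
have H := @cvg_differentiation_under_integral R d T P f setT measurableT s (s / 2)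
  (s + 1) Is _ _ G _ _ _.
have {}H : h^-1 *: (exp_moment k (h + s) - exp_moment k s) @[h --> 0^'] -->
    - exp_moment k.+1 s.
  have -> : - exp_moment k.+1 s = \int[P]_w partial1of2 f s w.
    rewrite -mulN1r -RintegralZl//; last exact: integrable_exp_moment.
    by apply: eq_Rintegral => w _; rewrite p1 mulN1r.
  apply: H.
  - by move=> x /pos; exact: integrable_exp_moment.
  - by move=> x w _ _; have [] := df x w.
  - by move=> w; rewrite divr_ge0 ?exprn_ge0 ?(ltW s2).
  - exact: finite_measure_integrable_cst.
  - move=> x w /[dup] /pos x0; rewrite /= in_itv /= => /andP[sx _] _.
    rewrite p1 normrN ger0_norm ?mulr_ge0 ?exprn_ge0 ?expR_ge0//.
    apply: le_trans (exp_moment_bound _ x0 (X_ge0 w)) _.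
    rewrite ler_wpM2l// lef_pV2 ?posrE ?exprn_gt0//.
    by rewrite lerXn2r ?nnegrE ?(ltW s2) ?(ltW x0)// ltW.
apply: DeriveDef.
  apply/cvg_ex; exists (- exp_moment k.+1 s).
  by under eq_fun do rewrite scaler1.
by rewrite -derive1E; exact: (cvg_lim _ H).
Qed.

Variables (alpha tau : R).
Hypotheses (alpha_gt0 : 0 < alpha) (alpha_lt1 : alpha < 1) (tau_ge0 : 0 <= tau).
Hypothesis X_laplace : forall s : R, 0 < s ->
  'E_P[fun w => expR (- s * X w)]%E = (expR (- tau * s `^ alpha))%:E.

(** Induction on [k] from the Laplace transform: the two sides agree near [s], hence so do their
    derivatives, each of which is the next level up to a sign. *)
Lemma exp_moment_stable k (s : R) : 0 < s ->
  exp_moment k s = (-1) ^+ k * stretched_exp_deriv alpha tau k s.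
Proof.
elim: k s => [|k IH] s s0.
  rewrite expr0 mul1r stretched_exp_deriv0// /exp_moment.
  under eq_Rintegral do rewrite expr0 mul1r.
  by rewrite /Rintegral; move: (X_laplace s0); rewrite unlock => ->.
have dM := exp_moment_is_derive k s0.
have dH := is_deriveZ ((-1) ^+ k : R)
  (stretched_exp_deriv_is_derive alpha_gt0 alpha_lt1 tau_ge0 k s0).
have eqM : \forall x \near s,
    exp_moment k x = ((-1) ^+ k *: stretched_exp_deriv alpha tau k) x.
  near=> x; rewrite IH//; near: x; exact: lt_nbhsr.
have [_ e1] := near_eq_is_derive eqM dM; have [_ e2] := dH.
rewrite exprS mulN1r mulNr; apply: oppr_inj; rewrite opprK.
by rewrite -e1 e2.
Unshelve. all: by end_near. Qed.

(** The mean Poisson weight is [s ^ k / k!] times [exp_moment k s]; here [s] acts as the Poisson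
    intensity and [tau] as the time of the subordinator. *)
Lemma cvg_mixed_poisson_stable k s : 0 < s ->
  series (fun r => gbinom (alpha * r%:R) k *
      ((- (s `^ alpha)) ^+ r * (-1) ^+ k / r`!%:R) * tau ^+ r) @ \oo -->
  (\int[P]_w ((s * X w) ^+ k / k`!%:R * expR (- (s * X w))))%R.
Proof.
move=> s0; have -> : \int[P]_w ((s * X w) ^+ k / k`!%:R * expR (- (s * X w))) =
    s ^+ k / k`!%:R * exp_moment k s.
  rewrite -RintegralZl//; last exact: integrable_exp_moment.
  by apply: eq_Rintegral => w _; rewrite exprMn mulNr; ring.
by rewrite exp_moment_stable//; exact: cvg_stretched_exp_deriv.
Qed.

End exponential_moments.

(** * Poisson process at an independent random time *)

Lemma bounded_convergence {d : measure_display} {T : measurableType d}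
    {R : realType} (P : probability T R) (f_ : nat -> T -> R) (f : T -> R) (C : R) :
  (forall n, measurable_fun setT (f_ n)) -> (forall n w, `|f_ n w| <= C) ->
  (forall w, f_ n w @[n --> \oo] --> f w) ->
  (\int[P]_w (f_ n w)%:E)%E @[n --> \oo] --> (\int[P]_w (f w)%:E)%E.
Proof.
move=> mf_ f_C f_f; have mf : measurable_fun setT f.
  by apply: (measurable_fun_cvg mf_) => w _; exact: f_f.
have [] // := @dominated_convergence _ T R P setT measurableT
  (fun n w => (f_ n w)%:E) (EFin \o f) (EFin \o cst C).
- by move=> n; exact/measurable_EFinP.
- exact/measurable_EFinP.
- by apply: aeW => w _; apply: cvg_EFin; [exact: nearW|exact: f_f].
- exact: finite_measure_integrable_cst.
- by apply: aeW => w n _; rewrite /= lee_fin.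
Qed.

Lemma eq_natr_dist_lt1 {R : realDomainType} (m n : nat) :
  `|m%:R - n%:R| < 1 :> R -> m = n.
Proof.
rewrite ltr_norml => /andP[nm mn]; apply/eqP; rewrite eqn_leq.
apply/andP; split; rewrite -ltnS -(ltr_nat R) -natr1 -ltrBlDl//.
by rewrite -opprB ltrNl.
Qed.

Section poisson_time_change.
Context {d : measure_display} {T : measurableType d} {R : realType}
  (P : probability T R).
Variables (lambda : R) (N : R -> {RV P >-> nat}) (X : T -> R).
Hypotheses (lambda_gt0 : 0 < lambda) (hN : poisson_process lambda N).
Hypotheses (mX : measurable_fun setT X) (X_ge0 : forall w, 0 <= X w).
Hypothesis ind : forall (s : R) (k : nat) (A : set R), 0 <= s -> measurable A ->
  P ([set w | N s w = k] `&` X @^-1` A) =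
  (P [set w | N s w = k] * P (X @^-1` A))%E.

(** [approx n] rounds [X] up to the grid of mesh [1 / (n + 1)], so that it takes countably many
    values, one on each [cell]. Rounding is strict: right limits use points beyond [X w], and
    [prob_N] requires a positive time. *)
Let cell (n m : nat) : set T := [set w | Num.truncn (n.+1%:R * X w) = m].
Let node (n m : nat) : R := m.+1%:R / n.+1%:R.
Let approx (n : nat) (w : T) : R := node n (Num.truncn (n.+1%:R * X w)).

Let cellE n m : cell n m = X @^-1` `[m%:R / n.+1%:R, m.+1%:R / n.+1%:R[.
Proof.
apply/seteqP; split => w; rewrite /cell /= in_itv /= ler_pdivrMr// ltr_pdivlMr//;
  rewrite -truncn_eq ?mulr_ge0// mulrC => /eqP //.
Qed.

Let measurable_cell n m : measurable (cell n m).
Proof. by rewrite cellE -[X in measurable X]setTI; exact: mX. Qed.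

Let trivIset_cell n : trivIset setT (cell n).
Proof. by move=> i j _ _ [w [/= <- <-]]. Qed.

Let bigcup_cell n : \bigcup_m cell n m = setT.
Proof. by apply/seteqP; split => // w _; exists (Num.truncn (n.+1%:R * X w)). Qed.

Let node_gt0 n m : 0 < node n m.
Proof. exact: divr_gt0. Qed.

Let approx_gt n w : X w < approx n w.
Proof.
rewrite /approx /node ltr_pdivlMr// mulrC.
by have /andP[] := truncn_itv (mulr_ge0 (ler0n R n.+1) (X_ge0 w)).
Qed.

Let approx_le n w : approx n w <= X w + n.+1%:R^-1.
Proof.
rewrite /approx /node ler_pdivrMr// mulrDl mulVf//.
rewrite -[(Num.truncn _).+1%:R]natr1 lerD2r [leRHS]mulrC.
by have /andP[] := truncn_itv (mulr_ge0 (ler0n R n.+1) (X_ge0 w)).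
Qed.

Let cvg_approx w : approx n w @[n --> \oo] --> X w.
Proof.
apply: (@squeeze_cvgr _ _ _ _ (cst (X w)) (fun n => X w + n.+1%:R^-1)).
- by apply: nearW => n; rewrite /= ltW ?approx_gt ?approx_le.
- exact: cvg_cst.
- rewrite -[X in _ --> X]addr0; apply: cvgD; first exact: cvg_cst.
  exact: cvg_harmonic.
Qed.

(** Right continuity brings the values within distance [1] of the limit, and naturals that close are
    equal. *)
Let N_right_continuous w : \forall n \near \oo, N (approx n w) w = N (X w) w.
Proof.
have := path_right_continuous (poisson_paths hN) (w := w) (X_ge0 w).
move/cvg_at_rightP => /(_ (fun n => approx n w)) H.
have {}H := H (conj (fun n => approx_gt n w) (@cvg_approx w)).
have /cvgrPdist_lt/(_ _ ltr01) := H.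
by apply: filterS => n; rewrite distrC => /eq_natr_dist_lt1.
Qed.

Variable k : nat.
Let hit n : set T := [set w | N (approx n w) w = k].
Let hitE n : hit n = \bigcup_m ([set w | N (node n m) w = k] `&` cell n m).
Proof.
apply/seteqP; split => w.
  by move=> h; exists (Num.truncn (n.+1%:R * X w)).
by move=> [m _ [/= h cm]]; rewrite /hit /= /approx cm.
Qed.

Let measurable_N s : measurable [set w | N s w = k].
Proof.
rewrite -[X in measurable X]setTI.
exact: (@measurable_funPT _ _ _ _ (N s) measurableT [set k]).
Qed.

Let measurable_hit_approx n m :
  measurable ([set w | N (node n m) w = k] `&` cell n m).
Proof. exact: measurableI. Qed.

Let measurable_hit n : measurable (hit n).
Proof. by rewrite hitE; exact: bigcup_measurable. Qed.

Let pmf (x : R) : R := (lambda * x) ^+ k / k`!%:R * expR (- (lambda * x)).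

Let pmf_ge0 x : 0 <= x -> 0 <= pmf x.
Proof.
move=> x0; rewrite /pmf mulr_ge0 ?expR_ge0// divr_ge0// exprn_ge0//.
by rewrite mulr_ge0// ltW.
Qed.

Let pmf_le1 x : 0 <= x -> `|pmf x| <= 1.
Proof.
move=> x0; rewrite ger0_norm ?pmf_ge0// /pmf expRN ler_pdivrMr ?expR_gt0// mul1r.
by apply: exp_coeff_le; rewrite mulr_ge0// ltW.
Qed.

Let continuous_pmf : continuous pmf.
Proof.
move=> x; apply: cvgM.
  apply: cvgMr_tmp; apply: (continuous_cvg _ (@exprn_continuous R k _)).
  by apply: cvgMl_tmp; exact: cvg_id.
apply: (continuous_cvg _ (@continuous_expR R _)).
by apply: cvgN; apply: cvgMl_tmp; exact: cvg_id.
Qed.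

Let prob_N s : 0 < s -> P [set w | N s w = k] = (pmf s)%:E.
Proof.
move=> s0; have := poisson_law hN k (lexx 0) s0.
rewrite subr0 /poisson_pmf mulr_gt0// => <-; congr (P _).
apply/seteqP; split => w /=.
all: have /eqP := path_start (poisson_paths hN) w.
all: by rewrite pnatr_eq0 => /eqP ->; rewrite subn0.
Qed.

Let measurable_approx n : measurable_fun setT (approx n).
Proof.
move=> _ B mB; rewrite setTI.
have -> : approx n @^-1` B = \bigcup_(m in [set m | B (node n m)]) cell n m.
  apply/seteqP; split => w; first by move=> h; exists (Num.truncn (n.+1%:R * X w)).
  by move=> [m /= h cm]; rewrite /approx cm.
exact: bigcup_measurable.
Qed.

(** The time is constant on each cell, where independence factors the probability; countable
    additivity sums over the cells. *)
Let prob_hit n : P (hit n) = (\int[P]_w (pmf (approx n w))%:E)%E.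
Proof.
have mf : measurable_fun setT (fun w => pmf (approx n w)).
  apply: measurableT_comp; last exact: measurable_approx.
  exact: continuous_measurable_fun.
rewrite hitE measure_semi_bigcup//; last 2 first.
- by apply: trivIset_setIl; exact: trivIset_cell.
- by rewrite -hitE; exact: measurable_hit.
have := @ge0_integral_bigcup _ T R P (cell n) (fun w => (pmf (approx n w))%:E)
  (@measurable_cell n).
rewrite bigcup_cell => -> //; last first.
- by move=> w _; rewrite lee_fin pmf_ge0// ltW// (le_lt_trans (X_ge0 w)).
- exact/measurable_EFinP.
apply: eq_eseriesr => m _.
have -> : (\int[P]_(w in cell n m) (pmf (approx n w))%:E =
    \int[P]_(w in cell n m) cst (pmf (node n m))%:E w)%E.
  by apply: eq_integral => w; rewrite inE /approx => ->.
rewrite integral_cst// -prob_N// cellE.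
by apply: ind; [exact: ltW|exact: measurable_itv].
Qed.

Let cvg_indic_hit w :
  (\1_(hit n) w : R) @[n --> \oo] --> (\1_[set w | N (X w) w = k] w : R).
Proof.
apply: cvg_near_cst; apply: filterS (N_right_continuous w) => n Nn.
rewrite !indicE; congr ((nat_of_bool _)%:R).
by apply/idP/idP; rewrite !in_setE /hit /= Nn.
Qed.

Lemma measurable_poisson_time_change : measurable [set w | N (X w) w = k].
Proof.
apply/(measurable_indicP R).
apply: (@measurable_fun_cvg _ _ _ setT (fun n => \1_(hit n))).
  by move=> n; apply: measurable_indic; exact: measurable_hit.
by move=> w _; exact: cvg_indic_hit.
Qed.

(** Bounded convergence passes to the limit on both sides of [prob_hit]: the indicators converge by
    right continuity of the paths, the weights by continuity of [pmf]. *)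
Lemma prob_poisson_time_change :
  P [set w | N (X w) w = k] =
  (\int[P]_w ((lambda * X w) ^+ k / k`!%:R * expR (- (lambda * X w))))%:E.
Proof.
rewrite /Rintegral fineK; last first.
  apply: integrable_fin_num => //.
  apply: (@bounded_integrable _ _ _ P (fun w => pmf (X w)) 1).
    by apply: (measurableT_comp _ mX); exact: continuous_measurable_fun.
  by move=> w; exact: pmf_le1.
have h1 : (\int[P]_w (pmf (approx n w))%:E)%E @[n --> \oo] -->
    P [set w | N (X w) w = k].
  have -> : P [set w | N (X w) w = k] =
      (\int[P]_w (\1_[set w | N (X w) w = k] w)%:E)%E.
    by rewrite integral_indic ?setIT//; exact: measurable_poisson_time_change.
  have -> : (fun n => \int[P]_w (pmf (approx n w))%:E)%E =
      (fun n => \int[P]_w (\1_(hit n) w)%:E)%E.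
    by apply/funext => n; rewrite -prob_hit integral_indic ?setIT.
  apply: (bounded_convergence (C := 1)).
  - by move=> n; apply: measurable_indic; exact: measurable_hit.
  - by move=> n w; rewrite indicE; case: (_ \in _); rewrite ?normr1 ?normr0.
  - exact: cvg_indic_hit.
apply: (cvg_unique _ h1) => //.
apply: (bounded_convergence (C := 1)).
- move=> n; apply: measurableT_comp; last exact: measurable_approx.
  exact: continuous_measurable_fun.
- by move=> n w; rewrite pmf_le1// ltW// (le_lt_trans (X_ge0 w)).
- move=> w.
  exact: (@continuous_cvg _ _ _ _ _ _ pmf _ (@continuous_pmf _) (@cvg_approx w)).
Qed.

End poisson_time_change.

(** * Law of the geometric counting process *)

Section gamma_integral.
Context {R : realType} (b : R).
Hypothesis b_gt0 : 0 < b.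
Let mu := @lebesgue_measure R.

(** Poisson weight of [m] at mean [b x]; multiplied by [b], it is the Erlang density of shape
    [m + 1] and rate [b]. *)
Definition erlang_term (m : nat) (x : R) : R :=
  (b * x) ^+ m / m`!%:R * expR (- (b * x)).

Lemma erlang_term_ge0 m x : 0 <= x -> 0 <= erlang_term m x.
Proof.
move=> x0; rewrite mulr_ge0 ?expR_ge0// divr_ge0// exprn_ge0//.
by rewrite mulr_ge0// ltW.
Qed.

Let is_derive_expbx (x : R) :
  is_derive x (1 : R) (fun x => expR (- (b * x))) (- (b * expR (- (b * x)))).
Proof.
have d1 : is_derive x (1 : R) (fun x => - (b * x)) (- b).
  rewrite (_ : (fun x => _) = (- b) *: (@id R)); last first.
    by apply/funext => z; rewrite /= fctE /GRing.scale /= mulNr.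
  by apply: is_derive_eq (is_deriveZ _ (is_derive_id _ _)) _; exact: mulr1.
have := @is_derive1_comp _ expR (fun x => - (b * x)) x _ _ (is_derive_expR _) d1.
by move=> d2; apply: is_derive_eq d2 _; ring.
Qed.

Let erlang_term0_is_derive (x : R) :
  is_derive x (1 : R) (erlang_term 0) (- (b * erlang_term 0 x)).
Proof.
have E y : erlang_term 0 y = expR (- (b * y)).
  by rewrite /erlang_term expr0 fact0 divr1 mul1r.
by rewrite E (funext E).
Qed.

Let erlang_termS_is_derive m (x : R) :
  is_derive x (1 : R) (erlang_term m.+1)
    (b * (erlang_term m x - erlang_term m.+1 x)).
Proof.
have d1 : is_derive x (1 : R) (fun x => b * x) b.
  rewrite (_ : (fun x => _) = b *: (@id R)); last first.
    by apply/funext => z; rewrite /= fctE.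
  by apply: is_derive_eq (is_deriveZ _ (is_derive_id _ _)) _; exact: mulr1.
have scaleE (u v : R) : u *: v = u * v by [].
have d2 := is_deriveZ (m.+1`!%:R^-1)
  (is_deriveM (is_deriveX m.+1 d1) (is_derive_expbx x)).
rewrite (_ : erlang_term m.+1 =
    m.+1`!%:R^-1 *: ((fun x => b * x) ^+ m.+1 * (fun x => expR (- (b * x))))).
  apply: is_derive_eq d2 _; rewrite /erlang_term !fctE !scaleE /= factS natrM exprS.
  by field; rewrite nat1r !pnatr_eq0 -!lt0n fact_gt0.
by apply/funext => y; rewrite /erlang_term !fctE !scaleE /=; ring.
Qed.

(** Minus a Poisson distribution function; the derivatives of its summands telescope, which makes it
    a primitive of the Erlang density. *)
Let erlang_tail m (x : R) : R := - \sum_(i < m.+1) erlang_term i x.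

Let erlang_tail_is_derive m (x : R) :
  is_derive x (1 : R) (erlang_tail m) (b * erlang_term m x).
Proof.
elim: m => [|m IH].
  rewrite (_ : erlang_tail 0 = - erlang_term 0).
    by apply: is_derive_eq (is_deriveN (erlang_term0_is_derive x)) _; rewrite opprK.
  by apply/funext => y; rewrite /erlang_tail big_ord1.
rewrite (_ : erlang_tail m.+1 = erlang_tail m - erlang_term m.+1).
  by apply: is_derive_eq (is_deriveB IH (erlang_termS_is_derive m x)) _; ring.
by apply/funext => y; rewrite /erlang_tail big_ord_recr /= fctE opprD.
Qed.

Let cvg_erlang_term m : erlang_term m x @[x --> +oo%R] --> (0 : R).
Proof.
apply/cvgrPdist_le => e e0; near=> x.
have x0 : 0 < x by near: x; exact: nbhs_pinfty_gt.
have bx : 0 < b * x by rewrite mulr_gt0.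
rewrite sub0r normrN ger0_norm ?erlang_term_ge0 ?(ltW x0)// /erlang_term expRN.
rewrite ler_pdivrMr ?expR_gt0//.
(* Bounding the exponential by its term of order [m + 1] gains a factor [e b x / (m + 1)], at least
   [1] for large [x]. *)
apply: (@le_trans _ _ (e * ((b * x) ^+ m.+1 / m.+1`!%:R))); last first.
  by rewrite ler_wpM2l ?(ltW e0)//; apply: exp_coeff_le; exact: ltW.
have -> : e * ((b * x) ^+ m.+1 / m.+1`!%:R) =
    (b * x) ^+ m / m`!%:R * (e * b * x / m.+1%:R).
  by rewrite exprS factS natrM; field; rewrite nat1r !pnatr_eq0 -!lt0n fact_gt0.
rewrite ler_peMr//; first by rewrite divr_ge0// exprn_ge0// ltW.
rewrite ler_pdivlMr// mul1r mulrC.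
rewrite -ler_pdivrMr; last exact: mulr_gt0.
near: x; apply: nbhs_pinfty_ge; exact: num_real.
Unshelve. all: by end_near. Qed.

Lemma erlang_integral m :
  (\int[mu]_(x in `[0%R, +oo[) (b * erlang_term m x)%:E = 1)%E.
Proof.
have cont : continuous (fun x => b * erlang_term m x).
  move=> x; apply: cvgMl_tmp.
  suff [dx _] : is_derive x (1 : R) (erlang_term m)
     (if m is m'.+1 then b * (erlang_term m' x - erlang_term m x)
      else - (b * erlang_term m x)).
    exact/differentiable_continuous/derivable1_diffP.
  by case: m => [|m]; [exact: erlang_term0_is_derive|exact: erlang_termS_is_derive].
have dtail x : derivable (erlang_tail m) x 1.
  by have [] := erlang_tail_is_derive m x.
rewrite (@ge0_continuous_FTC2y R _ (erlang_tail m) 0 0).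
- rewrite /erlang_tail big_ord_recl big1 => [|i _]; last first.
    by rewrite /erlang_term mulr0 expr0n mul0r mul0r.
  rewrite /erlang_term mulr0 expr0 fact0 divr1 oppr0 expR0 mulr1 addr0.
  by rewrite -EFinB opprK add0r.
- by move=> x x0; rewrite mulr_ge0 ?erlang_term_ge0// ltW.
- exact: continuous_subspaceT.
- rewrite -[X in _ --> X]oppr0; apply: cvgN.
  suff H n : (fun x => \sum_(i < n) erlang_term i x) @ +oo%R --> (0 : R).
    exact: H.
  elim: n => [|n IH].
    rewrite (_ : (fun x => _) = cst 0); first exact: cvg_cst.
    by apply/funext => x; rewrite big_ord0.
  rewrite (_ : (fun x => _) =
      (fun x => \sum_(i < n) erlang_term i x + erlang_term n x)).
    rewrite -[X in _ --> X]addr0.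
    by apply: cvgD; [exact: IH|exact: cvg_erlang_term].
  by apply/funext => x; rewrite big_ord_recr.
- by move=> x _; exact: dtail.
- apply: cvg_at_right_filter.
  exact/differentiable_continuous/derivable1_diffP.
- by move=> x _; rewrite derive1E; have [_ ->] := erlang_tail_is_derive m x.
Qed.

Lemma measurable_erlang_term m : measurable_fun setT (erlang_term m).
Proof.
apply: measurable_funM.
  by apply: measurable_funM => //; apply: measurable_funX; exact: measurable_funM.
apply: measurableT_comp => //; apply: measurable_funN; exact: measurable_funM.
Qed.

End gamma_integral.

(** * Exponential mixture of Poisson laws *)

Section geometric_law.
Context {d : measure_display} {T : measurableType d} {R : realType}
  (P : probability T R).
Variables (mu : R) (G : R -> {RV P >-> nat}).
Hypotheses (mu_gt0 : 0 < mu) (hG : geometric_counting_process mu G).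

Let G0 w : G 0 w = 0%N.
Proof.
by have /eqP := path_start (geometric_paths hG) w; rewrite pnatr_eq0 => /eqP.
Qed.

(** The exponential density times the Poisson weight is [(1 - q) * q ^ j] times an Erlang density of
    rate [b = t + 1 / mu], whose integral is [1]. *)
Lemma prob_geometric_counting (t : R) (j : nat) : 0 <= t ->
  let q := mu * t / (1 + mu * t) in
  P [set w | G t w = j] = ((1 - q) * q ^+ j)%:E.
Proof.
(* Time [0] is treated apart because a [time_grid] increases strictly; there [q = 0] and [G] starts
   at [0]. *)
rewrite le_eqVlt => /predU1P[<-|t0] q.
  rewrite /q mulr0 mul0r subr0 mul1r expr0n.
  case: j => [|j] /=.
    rewrite (_ : [set w | _] = setT) ?probability_setT ?mulr1//.
    by apply/seteqP; split => w //= _; rewrite G0.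
  rewrite (_ : [set w | _] = set0) ?measure0//.
  by apply/seteqP; split => w //=; rewrite G0.
have mut : 0 < 1 + mu * t by rewrite addr_gt0// mulr_gt0.
have mut' : t * mu + 1 != 0 by rewrite addrC mulrC gt_eqF.
pose b := t + mu^-1; have b0 : 0 < b by rewrite addr_gt0// invr_gt0.
have grid : time_grid 1 (fun i => i%:R * t).
  by split => [|i]; rewrite ?mul0r// ltnS leqn0 => /eqP ->; rewrite mul0r mul1r.
have := geometric_mixed hG (fun=> j) grid.
rewrite (_ : \bigcap_(i in _) _ = [set w | G t w = j]); last first.
  apply/seteqP; split => w /=.
    by move=> /(_ 0%N erefl) /=; rewrite mul0r mul1r G0 subn0.
  by move=> Gj i /=; rewrite ltnS leqn0 => /eqP ->; rewrite /= mul0r mul1r G0 subn0.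
move=> ->.
have pdf_erlang x : 0 < x -> exponential_pdf mu^-1 x *
    \prod_(i < 1) poisson_pmf (x * (i.+1%:R * t - i%:R * t)) j =
    (1 - q) * q ^+ j * (b * erlang_term b j x).
  move=> x0; rewrite big_ord1 /= mul1r mul0r subr0 exponential_pdfE ?ltW//.
  rewrite /poisson_pmf mulr_gt0// /erlang_term.
  have -> : expR (- (b * x)) = expR (- mu^-1 * x) * expR (- (x * t)).
    by rewrite -expRD; congr expR; rewrite /b; ring.
  have -> : 1 - q = mu^-1 / b.
    by rewrite /q /b; field; rewrite mut' gt_eqF.
  have -> : q = t / b by rewrite /q /b; field; rewrite mut' gt_eqF.
  rewrite !exprMn exprVn; field.
  by rewrite pnatr_eq0 -lt0n fact_gt0 expf_neq0 ?gt_eqF.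
rewrite -integral_itv_obnd_cbnd; last first.
  apply/measurable_EFinP; apply: measurable_funTS; apply: measurable_funM.
    exact: measurable_exponential_pdf.
  under eq_fun do rewrite big_ord1.
  apply: (@measurableT_comp _ _ _ _ _ _ (fun r => poisson_pmf r j)).
    exact: measurable_poisson_pmf.
  exact: measurable_funM.
transitivity (\int[lebesgue_measure]_(x in `]0%R, +oo[)
    (((1 - q) * q ^+ j)%:E * (b * erlang_term b j x)%:E))%E.
  apply: eq_integral => x; rewrite inE /= in_itv /= andbT => x0.
  by rewrite pdf_erlang// EFinM.
have mterm : measurable_fun setT (fun x => (b * erlang_term b j x)%:E).
  apply/measurable_EFinP; apply: measurable_funM => //.
  exact: measurable_erlang_term.
rewrite integral_itv_obnd_cbnd; last first.
  by apply: measurable_funTS; exact: measurable_funeM.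
rewrite ge0_integralZl//.
- by rewrite erlang_integral// mule1.
- exact: measurable_funTS.
- move=> x; rewrite /= in_itv /= andbT => x0.
  by rewrite lee_fin mulr_ge0 ?(erlang_term_ge0 b0)// ltW.
- rewrite lee_fin mulr_ge0 ?exprn_ge0//.
    have -> : 1 - q = (1 + mu * t)^-1 by rewrite /q; field; rewrite gt_eqF.
    by rewrite invr_ge0 ltW.
  by rewrite divr_ge0 ?(ltW mut)// mulr_ge0// ltW.
Qed.

End geometric_law.

(** * From independence of processes to events at single times *)

Section independence.
Context {d : measure_display} {T : measurableType d} {R : realType}
  (P : probability T R).

Lemma process_sigma_preimage {d' : measure_display} {S : measurableType d'}
    (X : R -> T -> S) (t : R) (B : set S) :
  0 <= t -> measurable B -> process_sigma X (X t @^-1` B).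
Proof.
move=> t0 mB; apply: sub_sigma_algebra; exists t => //.
by exists B => //; rewrite setTI.
Qed.

Lemma independent_process_preimage {d1 d2 : measure_display}
    {S1 : measurableType d1} {S2 : measurableType d2}
    (X : R -> T -> S1) (Y : R -> T -> S2) (s t : R) (A : set S1) (B : set S2) :
  independent_processes P X Y -> 0 <= s -> 0 <= t -> measurable A -> measurable B ->
  P (X s @^-1` A `&` Y t @^-1` B) = (P (X s @^-1` A) * P (Y t @^-1` B))%E.
Proof. by move=> ind s0 t0 mA mB; apply: ind; exact: process_sigma_preimage. Qed.

End independence.

(** * Conditioning on the geometric process, and the convergence criterion *)

Theorem proposition3p3 (R : realType) (d : measure_display)
    (T : measurableType d) (P : probability T R) (alpha lambda mu : R)
    (N : R -> {RV P >-> nat}) (D : R -> {RV P >-> R}) (G : R -> {RV P >-> nat})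
    (alpha_gt0 : 0 < alpha) (alpha_lt1 : alpha < 1)
    (lambda_gt0 : 0 < lambda) (mu_gt0 : 0 < mu)
    (hN : poisson_process lambda N) (hD : stable_subordinator alpha D)
    (hG : geometric_counting_process mu G)
    (ind_ND : independent_processes P N D)
    (ind_G : independent_processes P (space_fractional N D) G)
    (t : R) (t_ge0 : 0 <= t) (k : nat) :
  let a := fun r : nat =>
    gbinom (alpha * r%:R) k
    * ((- (lambda `^ alpha)) ^+ r * (-1) ^+ k / r`!%:R)
    * (geom_poly r).[mu * t] in
  (cvgn (series a) <-> mu * t * (expR (lambda `^ alpha) - 1) < 1) /\
  (cvgn (series a) ->
   P [set w | geometric_space_fractional N D G t w = k] =
   (limn (series a))%:E).
Proof.
move=> a; set y := mu * t in a *; set c := lambda `^ alpha in a *.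
have y_ge0 : 0 <= y by rewrite mulr_ge0// ltW.
have c_gt0 : 0 < c by rewrite powR_gt0.
have y1 : 0 < 1 + y by rewrite ltr_pwDl.
pose q := y / (1 + y).
have q_ge0 : 0 <= q by rewrite divr_ge0// ltW.
have q_lt1 : q < 1 by rewrite ltr_pdivrMr// mul1r ltrDr.
have qy : q / (1 - q) = y.
  have -> : 1 - q = (1 + y)^-1 by rewrite /q; field; rewrite gt_eqF.
  by rewrite invrK divfK// gt_eqF.
have condE : (y * (expR c - 1) < 1) = (q * expR c < 1).
  by rewrite /q [in RHS]mulrAC [RHS]ltr_pdivrMr// mul1r mulrBr mulr1 ltrBlDr.
have aE : a = fun r => gbinom (alpha * r%:R) k *
    ((- c) ^+ r * (-1) ^+ k / r`!%:R) * (geom_poly r).[q / (1 - q)].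
  by apply/funext => r; rewrite qy.
have D_ge0 s w : 0 <= s -> 0 <= D s w.
  move=> s0; rewrite -(path_start (stable_paths hD) w).
  exact: (path_nondecreasing (stable_paths hD)).
have mD s : measurable_fun setT (D s) by exact: measurable_funPT.
(* Freezing [G t] at [j] leaves the Poisson process evaluated at the independent random time
   [D j]. *)
pose level j := [set w | space_fractional N D j%:R w = k].
pose p j : R := \int[P]_w ((lambda * D j%:R w) ^+ k / k`!%:R *
  expR (- (lambda * D j%:R w))).
have ind_D j s m A : 0 <= s -> measurable A ->
    P ([set w | N s w = m] `&` D j%:R @^-1` A) =
    (P [set w | N s w = m] * P (D j%:R @^-1` A))%E.
  by move=> s0 mA; exact: (independent_process_preimage (A := [set m]) ind_ND).
have mlevel j : measurable (level j).
  by apply: (measurable_poisson_time_change hN (mD j%:R)) => w; exact: D_ge0.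
have plevel j : P (level j) = (p j)%:E.
  rewrite /level /space_fractional.
  rewrite (prob_poisson_time_change lambda_gt0 hN (mD j%:R) _ (@ind_D j))// => w.
  exact: D_ge0.
have p_series j : series (fun r => gbinom (alpha * r%:R) k *
    ((- c) ^+ r * (-1) ^+ k / r`!%:R) * j%:R ^+ r) @ \oo --> p j.
  apply: cvg_mixed_poisson_stable => //.
  - by move=> w; exact: D_ge0.
  - by move=> s s0; apply: (stable_laplace hD); rewrite ?(ltW s0).
pose target := [set w | geometric_space_fractional N D G t w = k].
have targetE : target = \bigcup_j (level j `&` G t @^-1` [set j]).
  apply/seteqP; split => w.
    by move=> h; exists (G t w).
  by move=> [j _ [/= h Gj]]; rewrite /target /geometric_space_fractional /= Gj.
have mcell j : measurable (level j `&` G t @^-1` [set j]).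
  apply: measurableI => //; rewrite -[X in measurable X]setTI.
  exact: (@measurable_funPT _ _ _ _ (G t) measurableT [set j]).
have mtarget : measurable target by rewrite targetE; exact: bigcup_measurable.
have tcell : trivIset setT (fun j => level j `&` G t @^-1` [set j]).
  by move=> i j _ _ [w [[_ /= <-] [_ /= <-]]].
have pcell j : P (level j `&` G t @^-1` [set j]) = ((1 - q) * q ^+ j * p j)%:E.
  rewrite (independent_process_preimage (A := [set k]) ind_G)// plevel.
  by rewrite (prob_geometric_counting mu_gt0 hG j t_ge0) -EFinM mulrC.
(* Countable additivity over the values of [G t] writes the target probability as the geometric mean
   of the [p j]. *)
have l_series : series (fun j => (1 - q) * q ^+ j * p j) @ \oo --> fine (P target).
  rewrite (_ : series _ = fine \o
      (fun n => \sum_(0 <= j < n) P (level j `&` G t @^-1` [set j]))%E).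
    apply: fine_cvg; rewrite fineK ?fin_num_measure// targetE.
    by apply: measure_semi_sigma_additive => //; exact: bigcup_measurable.
  apply/funext => n; rewrite seriesEnat /=.
  by under [in RHS]eq_bigr do rewrite pcell; rewrite sumEFin.
have cvg_a : q * expR c < 1 -> series a @ \oo --> fine (P target).
  by rewrite aE; exact: geom_poly_series_cvg p_series l_series.
(* Above the threshold the terms do not tend to [0]; below it the exchange of sums gives convergence
   together with the value. *)
have cvg_iff : cvgn (series a) <-> q * expR c < 1.
  split=> [|/cvg_a /cvgP//]; rewrite aE => a_cvg; rewrite ltNge; apply/negP => qc.
  exact: (geom_poly_series_dvg alpha_gt0 c_gt0 q_ge0 q_lt1 qc a_cvg).
split; first by rewrite condE.
move=> /cvg_iff /cvg_a /cvg_lim ->//.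
by rewrite fineK// fin_num_measure.
Qed.
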